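(* Let $T>t_N$ and let $\mathcal{X}_u\subset\mathbb{R}^n$ be a given (unsafe) set. Consider the data-driven differential inclusion $$\dot x(t)\in co\{\dot X_-(t),\dot X_+(t)\},\qquad x(t_N)=x_N,$$ with $u\equiv0$, where $\dot X_\pm(t)=F(t)\pm M\sigma(t)$. Suppose there exist a function $B:\mathbb{R}^n\times[t_N,\infty)\to\mathbb{R}$, $(x,t)\mapsto B(x,t)$, continuously differentiable in $x$ and in $t$, and two positive definite Lebesgue measurable functions $W_+,W_-:\mathbb{R}^n\times[t_N,\infty)\to\mathbb{R}_{\ge0}$ such that $$B(x_T,T)-B(x_N,t_N)>0\quad\text{for all }x_T\in\mathcal{X}_u,$$ $$D_+B(x,t)(\dot X_-(t),1)\le -W_-(x,t)\quad\text{for all }t\in[t_N,T],\ x\in\mathcal{X},$$ $$D_+B(x,t)(\dot X_+(t),1)\le -W_+(x,t)\quad\text{for all }t\in[t_N,T],\ x\in\mathcal{X}.$$ Then every solution $x(\cdot)$ of the differential inclusion satisfies $x(T)\notin\mathcal{X}_u$.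
   Context: $co$ denotes the convex hull. Samples of state and input are available at times $t_1\le\cdots\le t_N$, and $x_N\in\mathbb{R}^n$ is the state at time $t_N$. $\mathcal{X}\subseteq\mathbb{R}^n$ is the state set. A spline fit of the data gives a model for each state component, $$X_l(t)=\sum_{i=1}^L\sum_{j=1}^m c_{i,j}^l Q_{i,j}^l(t)\,(a_{0,j}^l+a_{1,j}^l u_j),\quad l=1,\dots,n,$$ with $Q_{i,j}^l$ B-spline basis functions (piecewise polynomials in $t$) and real coefficients. Its time derivative is $\dot X(t)=F(t)+G(t)u$, where $F:\mathbb{R}_{\ge0}\to\mathbb{R}^n$ has components $\sum_{i,j}a_{0,j}^lc_{i,j}^l\dot Q_{i,j}^l(t)$ and $G(t)\in\mathbb{R}^{n\times m}$ has entries $\sum_i a_{1,j}^lc_{i,j}^l\dot Q_{i,j}^l(t)$ in row $l$, column $j$. Thus $F$ and $G$ are piecewise polynomial in $t$. $M>0$ is a constant and $\sigma:\mathbb{R}_{\ge0}\to\mathbb{R}_{\ge0}$ is a function with $|\dot X(t)-\dot x(t)|\le M\sigma(t)$ (side information). In general $\dot X_\pm(t)=F(t)+G(t)u\pm M\sigma(t)$, where the scalar $M\sigma(t)$ is added to (subtracted from) every component; for $u\equiv0$ this is $F(t)\pm M\sigma(t)$. A solution on $[t_N,T]$ is an absolutely continuous $\mathcal{X}$-valued function satisfying the inclusion for almost every $t$ and the initial condition. The upper contingent derivative of a real function $V$ at $z$ in direction $f$ is $D_+V(z)(f)=\liminf_{h\to0^+,\,v\to f}\frac{V(z+hv)-V(z)}{h}$,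 equal to $\nabla V(z)^Tf$ when $V$ is differentiable. In $D_+B(x,t)(v,1)$ the direction is $v$ in the $x$-variable and $1$ in the $t$-variable. *)

(* Defs.v *)
From HB Require Import structures.
From mathcomp Require Import all_boot all_order all_algebra.
From mathcomp Require Import all_classical all_reals all_analysis.

Set Implicit Arguments.
Unset Strict Implicit.
Unset Printing Implicit Defensive.

Import Order.TTheory GRing.Theory Num.Theory.
Import numFieldNormedType.Exports.

Local Open Scope classical_set_scope.
Local Open Scope ring_scope.

Section Splines.
Variable R : realType.

(* Cox-de Boor recursion for the i-th B-spline of degree d on the knots k.
   The usual convention 0 / 0 = 0 for repeated knots is the one of MathComp
   fields, where x / 0 = 0. *)
Fixpoint bspline (k : nat -> R) (d i : nat) (t : R) : R :=
  if d is d'.+1 then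
    (t - k i) / (k (i + d)%N - k i) * bspline k d' i t
    + (k (i + d).+1 - t) / (k (i + d).+1 - k i.+1) * bspline k d' i.+1 t
  else if k i <= t < k i.+1 then 1 else 0.

(* Splines are right-continuous and piecewise polynomial, so this limit always
   exists on them; it is the derivative wherever the latter exists, and at the
   finitely many knots where it may not, it selects the polynomial piece to the
   right of the knot. *)
Definition right_derive (f : R -> R) (t : R) : R :=
  lim ((f (t + h) - f t) / h @[h --> 0^'+]).

(* X_l(t) = \sum_(i, j) coef l i j * Q l i j t * (a0 l j + a1 l j * u j), where
   Q l i j is the i-th B-spline for the given degree and knots. *)
Record spline_model (n m L : nat) := SplineModel {
  knot : 'I_n -> 'I_m -> nat -> R ;
  knot_nondecreasing : forall l j, nondecreasing_seq (knot l j) ;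
  degree : 'I_n -> 'I_m -> nat ;
  coef : 'I_n -> 'I_L -> 'I_m -> R ;
  a0 : 'I_n -> 'I_m -> R ;
  a1 : 'I_n -> 'I_m -> R }.

Context {n m L : nat}.
Implicit Type S : spline_model n m L.

Definition Q S (l : 'I_n) (i : 'I_L) (j : 'I_m) : R -> R :=
  bspline (knot S l j) (degree S l j) i.

Definition F S (t : R) : 'cV[R]_n :=
  \col_l \sum_(i < L) \sum_(j < m)
    a0 S l j * coef S l i j * right_derive (Q S l i j) t.

Definition G S (t : R) : 'M[R]_(n, m) :=
  \matrix_(l, j) \sum_(i < L) a1 S l j * coef S l i j * right_derive (Q S l i j) t.

Definition Xdot_minus S (M : R) (sigma : R -> R) (u : R -> 'cV[R]_m) (t : R) :
  'cV[R]_n := F S t + G S t *m u t - const_mx (M * sigma t).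

Definition Xdot_plus S (M : R) (sigma : R -> R) (u : R -> 'cV[R]_m) (t : R) :
  'cV[R]_n := F S t + G S t *m u t + const_mx (M * sigma t).

End Splines.

Section DifferentialInclusions.
Variable R : realType.

Definition convex_hull (E : lmodType R) (A : set E) : set E :=
  \bigcap_(C in [set C : set E | A `<=` C /\ convex_set C]) C.

Context {n : nat}.

Definition absolutely_continuous (a b : R) (x : R -> 'cV[R]_n) : Prop :=
  forall e : R, 0 < e -> exists2 d : R, 0 < d &
    forall (k : nat) (I : 'I_k -> R * R),
      (forall i, [/\ a <= (I i).1, (I i).1 <= (I i).2 & (I i).2 <= b]) ->
      trivIset setT (fun i => `](I i).1, (I i).2[%classic) ->
      \sum_(i < k) ((I i).2 - (I i).1) < d ->
      \sum_(i < k) `|x (I i).2 - x (I i).1| < e.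

Definition solution (Phi : R -> set 'cV[R]_n) (X : set 'cV[R]_n) (a b : R)
    (xa : 'cV[R]_n) (x : R -> 'cV[R]_n) : Prop :=
  [/\ absolutely_continuous a b x,
      forall t : R, a <= t <= b -> X (x t),
      {ae @lebesgue_measure R, forall t : R, a <= t <= b ->
        derivable x t 1 /\ Phi t (derive1 x t)} &
      x a = xa].

End DifferentialInclusions.

Section Derivatives.
Context {R : realType} {E : normedModType R}.

Definition upper_contingent_derivative (V : E -> R) (z f : E) : \bar R :=
  limf_einf (fun p : R * E => ((V (z + p.1 *: p.2) - V z) / p.1)%:E)
    (filter_prod 0^'+ (nbhs f)).

(* The directional derivative of V along v exists at every point of D, relatively
   to D (so it is one-sided where D allows only one sign of h), and is continuous
   on D. *)
Definition continuously_differentiable_along (D : set E) (V : E -> R) (v : E) :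
    Prop :=
  exists2 p : E -> R,
    (forall z, D z ->
      (V (z + h *: v) - V z) / h
        @[h --> within [set h | D (z + h *: v)] 0^'] --> p z) &
    {within D, continuous p}.

End Derivatives.

Section SpaceTime.
Context {R : realType} {n : nat}.
Local Notation E := ('cV[R]_n * R)%type.

Definition space_time (t0 : R) : set E := [set z | t0 <= z.2].

Definition C1_in_x (D : set E) (V : E -> R) : Prop :=
  forall i : 'I_n, continuously_differentiable_along D V (delta_mx i 0, 0).

Definition C1_in_t (D : set E) (V : E -> R) : Prop :=
  continuously_differentiable_along D V (0, 1).

Definition positive_definite (D : set E) (W : E -> R) : Prop :=
  forall x t, D (x, t) -> W (0, t) = 0 /\ (x != 0 -> 0 < W (x, t)).

Definition box (a b : E) : set E :=
  [set z : E | (forall i, a.1 i 0 <= z.1 i 0 <= b.1 i 0) /\ a.2 <= z.2 <= b.2].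

(* The maxima account for empty boxes. *)
Definition volume (a b : E) : R :=
  (\prod_(i < n) Num.max 0 (b.1 i 0 - a.1 i 0)) * Num.max 0 (b.2 - a.2).

Definition lebesgue_outer (A : set E) : \bar R :=
  ereal_inf [set s | exists2 ab : nat -> E * E,
    A `<=` \bigcup_k box (ab k).1 (ab k).2 &
    s = (\sum_(0 <= k <oo) (volume (ab k).1 (ab k).2)%:E)%E].

Definition lebesgue_measurable_fun (D : set E) (W : E -> R) : Prop :=
  forall Y : set R, measurable Y ->
    lebesgue_outer.-caratheodory (D `&` W @^-1` Y).

End SpaceTime.

(* Main.v *)
Require Import Defs.
From HB Require Import structures.
From mathcomp Require Import all_boot all_order all_algebra.
From mathcomp Require Import all_classical all_reals all_analysis.
From mathcomp Require Import ring lra.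
Import Order.TTheory GRing.Theory Num.Theory.
Import numFieldNormedType.Exports.
Local Open Scope classical_set_scope.
Local Open Scope ring_scope.

(** The function t |-> B (x t, t) is nonincreasing along every solution x, so
B (x T, T) <= B (xN, tN), which is incompatible with x T being unsafe.

Pointwise, the hypotheses give this sign.  The partial derivatives of B are
continuous, so B has at each point (x, t) a linear differential.  For a
direction (v, 1) the perturbed directions occurring in the contingent derivative
still point towards later times, so they stay in the half space t >= tN and the
contingent derivative is at least the differential applied to (v, 1)
([le_upper_contingent_derivative]).  The differential is therefore at most
-W <= 0 on both extreme velocities, and by linearity on their convex hull
([convex_hull_spacetime_form]), hence on the velocity of the solution at almost
every time.

To integrate this sign one needs that an absolutely continuous function whose
derivative is almost everywhere nonpositive does not increase
([le_of_ae_local]).  Cover the exceptional null set by an open set U of small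
measure.  Around a time outside U the increments are at most e times the elapsed
time; around a time in U a whole interval lies in U, and absolute continuity
makes the total increment over disjoint intervals in U small.  Such local
information is assembled over the whole interval by [cousin_interval], the
additive form of Cousin's covering lemma, proved by a supremum argument.

The same covering lemma is used twice more: it yields the mean value inequality
behind the differentiability of B ([increment_along],
[C1_strictly_differentiable]), where the derivative is one-sided at the boundary
of the half space, and it reduces the monotonicity to short time intervals
([nonincreasing_along_trajectory]).  On those B is Lipschitz, so that
t |-> B (x t, t) inherits absolute continuity from x with no global bound on the
derivatives of B.

Differentiability of B is used in the strict form, which compares two points
that both vary near z.  It covers at once the Lipschitz bound, the contingent
derivative and the chain rule, and its coordinatewise proof gives it for free. *)

(** * Covering an interval by local estimates *)

Section IntervalFunctions.
Context {R : realType}.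

(** The supremum c of the times reachable from a is itself passed: the local
hypothesis at c joins a reachable time just before c to times just after it.
Only intervals containing the point c are demanded to satisfy P, which is what
a derivative at c can control. *)
Lemma cousin_interval (a b : R) (P : R -> R -> Prop) : a <= b ->
    (forall s t u, a <= s -> s <= t -> t <= u -> u <= b ->
       P s t -> P t u -> P s u) ->
    (forall c, a <= c <= b -> exists2 r, 0 < r &
       forall s t, a <= s -> c - r <= s -> s <= c ->
         c <= t -> t <= c + r -> t <= b -> P s t) ->
  P a b.
Proof.
move=> ab Padd Ploc.
pose A := [set t | a <= t <= b /\ P a t].
have Aa : A a.
  split; first by rewrite lexx.
  by have [|r r0] := Ploc a; [rewrite lexx | apply; lra].
have hA : has_sup A by split; [exists a | exists b => t [/andP[]]].
pose c := sup A.
have ac : a <= c by exact: sup_upper_bound.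
have cb : c <= b by apply: ge_sup; [exists a | move=> t [/andP[]]].
have [|r r0 Pr] := Ploc c; first by rewrite ac.
have [t [/andP[at_ tb] Pt] crt] := sup_adherent r0 hA.
have tc : t <= c by apply: sup_upper_bound => //; split; first by rewrite at_.
pose d := Num.min b (c + r).
have db : d <= b by rewrite ge_min lexx.
have dcr : d <= c + r by rewrite ge_min lexx orbT.
have cd : c <= d by rewrite le_min cb; lra.
have Pd : P a d.
  by apply: (Padd a t d) => //; [lra | apply: Pr => //; apply: ltW].
have dc : d <= c.
  by apply: sup_upper_bound => //; split=> //; rewrite db andbT (le_trans ac).
have bd : b <= d.
  by move: dc; rewrite /d ge_min => /orP[bc|]; [rewrite le_min; lra | lra].
by rewrite (_ : b = d) //; apply/eqP; rewrite eq_le bd db.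
Qed.

(** A mean value inequality without any choice of an intermediate point, so that
one-sided derivatives at a and b are enough. *)
Lemma le_increment_of_local (f : R -> R) (a b k : R) : a <= b ->
    (forall c e : R, a <= c <= b -> 0 < e -> exists2 r, 0 < r &
       forall s t, a <= s -> c - r <= s -> s <= c ->
         c <= t -> t <= c + r -> t <= b ->
         f t - f s <= (k + e) * (t - s)) ->
  f b - f a <= k * (b - a).
Proof.
move=> ab floc; apply/ler_addgt0Pr => e e0.
have [d d0 de] : exists2 d, 0 < d & d * (b - a) <= e.
  exists (e / (b - a + 1)); first by apply: divr_gt0 => //; lra.
  rewrite mulrAC ler_pdivrMr; last by lra.
  by rewrite ler_pM2l //; lra.
suff : f b - f a <= (k + d) * (b - a) by move: de; nra.
apply: (cousin_interval _ _ (fun s t => f t - f s <= (k + d) * (t - s))) => //.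
  by move=> s t u _ _ _ _; nra.
by move=> c cab; exact: floc.
Qed.

(** * Absolutely continuous functions with a sign condition almost everywhere *)

(** Stated for a function of intervals and one-sided in its values, since only
upper bounds of the increments f t - f s are ever needed. *)
Definition sum_absolutely_continuous (a b : R) (v : R -> R -> R) : Prop :=
  forall e : R, 0 < e -> exists2 d : R, 0 < d &
    forall (k : nat) (I : 'I_k -> R * R),
      (forall i, [/\ a <= (I i).1, (I i).1 <= (I i).2 & (I i).2 <= b]) ->
      trivIset setT (fun i => `](I i).1, (I i).2[%classic) ->
      \sum_(i < k) ((I i).2 - (I i).1) < d ->
      \sum_(i < k) v (I i).1 (I i).2 < e.

Lemma sum_length_le_measure (k : nat) (I : 'I_k -> R * R) (U : set R) :
    measurable U ->
    (forall i, (I i).1 <= (I i).2) ->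
    (forall i, `](I i).1, (I i).2[%classic `<=` U) ->
    trivIset setT (fun i => `](I i).1, (I i).2[%classic) ->
  ((\sum_(i < k) ((I i).2 - (I i).1))%:E <= lebesgue_measure U)%E.
Proof.
move=> mU I12 IU tI.
have mI i : measurable `](I i).1, (I i).2[%classic by exact: measurable_itv.
rewrite (_ : _%:E =
    lebesgue_measure (\big[setU/set0]_(i < k) `](I i).1, (I i).2[%classic)).
  apply: le_measure; rewrite ?inE //; first exact: bigsetU_measurable.
  by rewrite -bigcup_seq => x [i _]; exact: IU.
rewrite measure_bigsetU_ord // // -sumEFin; apply: eq_bigr => i _.
rewrite [RHS](lebesgue_measure_itv `](I i).1, (I i).2[) /= lte_fin.
case: ltP => // I21; rewrite (_ : (I i).2 = (I i).1) ?subrr //.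
by apply/eqP; rewrite eq_le I21 I12.
Qed.

Lemma negligible_open_cover (N : set R) (d : R) : 0 < d ->
    (@lebesgue_measure R).-negligible N ->
  exists U : set R, [/\ open U, N `<=` U & (lebesgue_measure U < d%:E)%E].
Proof.
move=> d0 [A [mA A0 NA]].
have [|U [oU AU Ud]] := lebesgue_regularity_outer mA _ d0.
  by rewrite [X in (X < _)%E]A0.
exists U; split=> //; first exact: subset_trans AU.
have mU : measurable U by exact: measurable_realfun.open_measurable.
rewrite (measureDI lebesgue_measure mU mA).
rewrite [X in (_ + X)%E](_ : _ = 0%E) ?adde0 //.
apply/eqP; rewrite eq_le measure_ge0 andbT -[leRHS]A0.
by apply: le_measure; rewrite ?inE //; exact: measurableI.
Qed.

Lemma trivIset_pairwise_itv (l : seq (R * R)) :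
    pairwise (fun i j => i.2 <= j.1) l ->
  trivIset setT (fun i => `](tnth (in_tuple l) i).1,
                            (tnth (in_tuple l) i).2[%classic).
Proof.
move=> /(pairwiseP (0, 0)) pl.
have lt_disj (i j : 'I_(size l)) (x : R) : (i < j)%N ->
    x \in `](tnth (in_tuple l) i).1, (tnth (in_tuple l) i).2[ ->
    x \in `](tnth (in_tuple l) j).1, (tnth (in_tuple l) j).2[ -> False.
  move=> ij; rewrite !in_itv /= !(tnth_nth (0, 0)) /=.
  by have := pl i j (ltn_ord i) (ltn_ord j) ij; lra.
move=> i j _ _ [x [/= xi xj]]; apply/val_inj.
by case: (ltngtP i j) => // ij; exfalso; [apply: (lt_disj i j x) | apply: (lt_disj j i x)].
Qed.

(** The endpoints are thrown into the exceptional set, so the local bound is only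
asked at interior points. *)
Lemma le_of_ae_local (f : R -> R) (a b : R) (N : set R) : a <= b ->
    sum_absolutely_continuous a b (fun s t => f t - f s) ->
    (@lebesgue_measure R).-negligible N ->
    (forall c e : R, a < c < b -> ~ N c -> 0 < e -> exists2 r, 0 < r &
       forall s t, a <= s -> c - r <= s -> s <= c ->
         c <= t -> t <= c + r -> t <= b ->
         f t - f s <= e * (t - s)) ->
  f b <= f a.
Proof.
move=> ab fac N0 floc; apply/ler_addgt0Pr => e e0.
have [k k0 ke] : exists2 k, 0 < k & k * (b - a) <= e / 2.
  exists (e / 2 / (b - a + 1)); first by apply: divr_gt0; lra.
  rewrite mulrAC ler_pdivrMr; last by lra.
  by rewrite ler_pM2l; lra.
have [d d0 fd] := fac (e / 2) ltac:(lra).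
have [|U [oU NU Ud]] := @negligible_open_cover (N `|` [set a] `|` [set b]) _ d0.
  have neg1 c : (@lebesgue_measure R).-negligible [set c].
    by exists [set c]; split=> //; exact: lebesgue_measure_set1.
  by apply: negligibleU => //; apply: negligibleU.
(* Up to the slope k, the increment over [s, t] is carried by a list of disjoint
   intervals inside U.  Listing them from left to right makes the property
   additive by concatenation. *)
pose good s t := exists l : seq (R * R), [/\
  {in l, forall i, [/\ s <= i.1, i.1 <= i.2, i.2 <= t &
     `]i.1, i.2[%classic `<=` U]},
  pairwise (fun i j => i.2 <= j.1) l &
  f t - f s <= k * (t - s) + \sum_(i <- l) (f i.2 - f i.1)].
have [l [lU lp lf]] : good a b.
  apply: cousin_interval => //.
    move=> s t u as_ st tu ub [l [lU lp lf]] [l' [lU' lp' lf']].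
    exists (l ++ l'); split.
    - move=> i; rewrite mem_cat => /orP[/lU|/lU'] [? ? ? ?]; split=> //; lra.
    - rewrite pairwise_cat lp lp' !andbT; apply/allrelP => i j il jl'.
      by have [_ _ + _] := lU i il; have [+ _ _ _] := lU' j jl'; lra.
    - by rewrite big_cat /=; lra.
  move=> c cab; have [Uc|nUc] := pselect (U c).
    have [r r0 rU] : exists2 r : R, 0 < r & ball c r `<=` U.
      have /(_ c Uc) := oU; rewrite /interior /= => /nbhs_ballP[r r0 rU].
      by exists r.
    exists (r / 2); first lra.
    move=> s t as_ cs sc ct tc tb; exists [:: (s, t)]; split=> //.
    - move=> i; rewrite inE => /eqP -> /=; split=> //; first lra.
      move=> x /=; rewrite in_itv /= => xst; apply: rU.
      by rewrite -ball_normE /= ltr_norml; lra.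
    - rewrite big_seq1 /=.
      have : 0 <= k * (t - s) by apply: mulr_ge0; lra.
      lra.
  have [] := floc c k _ _ k0.
  - have [ac bc] : c <> a /\ c <> b.
      by split=> cE; apply: nUc; apply: NU; rewrite cE; [left; right | right].
    move/eqP : ac; move/eqP : bc; move/andP : cab => [].
    by rewrite !lt_neqAle => -> -> -> /=; rewrite eq_sym => ->.
  - by move=> Nc; apply: nUc; apply: NU; left; left.
  move=> r r0 rf; exists r => // s t as_ cs sc ct tc tb; exists [::].
  by rewrite big_nil addr0; split=> //; exact: rf.
suff : \sum_(i <- l) (f i.2 - f i.1) < e / 2 by lra.
have lI i := lU _ (mem_tnth i (in_tuple l)).
have tI := trivIset_pairwise_itv _ lp.
rewrite big_tnth; apply: fd => //.
  by move=> i; have [? ? ? _] := lI i.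
rewrite -lte_fin; apply: le_lt_trans Ud.
apply: sum_length_le_measure => //.
- exact: measurable_realfun.open_measurable.
- by move=> i; have [? ? ? _] := lI i.
- by move=> i; have [? ? ? ?] := lI i.
Qed.

End IntervalFunctions.

(** * Strict differentiability from continuous partial derivatives *)

Section StrictDifferentiability.
Context {R : realType}.

(** The difference quotient of V at a point of the segment is only taken along
points of D; since the segment stays in D, this is the difference quotient of
h |-> V (y + h *: w) relative to [al, be], and the mean value inequality applies
to this function and to its opposite. *)
Lemma increment_along (E : normedModType R) (D : set E) (V p : E -> R)
    (y w : E) (al be k e : R) : al <= be ->
    (forall z, D z ->
      (V (z + h *: w) - V z) / h
        @[h --> within [set h | D (z + h *: w)] 0^'] --> p z) ->
    (forall h, al <= h <= be ->
      D (y + h *: w) /\ `|p (y + h *: w) - k| <= e) ->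
  `|V (y + be *: w) - V (y + al *: w) - k * (be - al)| <= e * (be - al).
Proof.
move=> albe Vp Dk; pose g h := V (y + h *: w).
have loc (c eta : R) : al <= c <= be -> 0 < eta -> exists2 r, 0 < r &
    forall h, `|h - c| <= r -> al <= h <= be ->
      `|g h - g c - (h - c) * p (y + c *: w)| <= eta * `|h - c|.
  move=> cab eta0; have [Dc _] := Dk c cab.
  have /cvgrPdist_le/(_ _ eta0) := Vp _ Dc.
  move=> /nbhs_norm0P[r /= r0 rP]; exists (r / 2); first by apply: divr_gt0.
  move=> h hr hab; have [->|hc] := eqVneq h c.
    by rewrite !subrr mul0r subr0 normr0 mulr0.
  have hc0 : h - c != 0 by rewrite subr_eq0.
  have hlt : `|h - c| < r by apply: le_lt_trans hr _; lra.
  have DE : y + c *: w + (h - c) *: w = y + h *: w.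
    by rewrite -addrA -scalerDl subrKC.
  have := rP _ hlt hc0; rewrite /= DE => /(_ (Dk _ hab).1).
  rewrite distrC -/(g h) -/(g c) => H.
  rewrite [X in `|X|](_ : _ = ((g h - g c) / (h - c) - p (y + c *: w)) * (h - c)).
    by rewrite normrM ler_wpM2r.
  by rewrite [RHS]mulrBl mulfVK // [p _ * _]mulrC.
have bounds (c eta : R) : al <= c <= be -> 0 < eta -> exists2 r, 0 < r &
    forall s t, al <= s -> c - r <= s -> s <= c ->
      c <= t -> t <= c + r -> t <= be ->
      `|g t - g s - k * (t - s)| <= (e + eta) * (t - s).
  move=> cab eta0; have [r r0 rP] := loc c eta cab eta0.
  exists r => // s t als cs sc ct tc tb; have [_] := Dk c cab.
  have : `|g t - g c - (t - c) * p (y + c *: w)| <= eta * (t - c).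
    by have := rP t; rewrite ger0_norm; [apply |]; lra.
  have : `|g s - g c - (s - c) * p (y + c *: w)| <= eta * (c - s).
    by have := rP s; rewrite distrC ger0_norm; [apply |]; lra.
  by move: (p _) => P; rewrite !ler_norml; nra.
have up : g be - g al <= (k + e) * (be - al).
  apply: le_increment_of_local => // c eta cab eta0.
  have [r r0 rP] := bounds c eta cab eta0; exists r => // s t *.
  by have := rP s t; rewrite ler_norml; lra.
have dn : (- g be) - (- g al) <= (e - k) * (be - al).
  apply: (le_increment_of_local (fun h => - g h)) => // c eta cab eta0.
  have [r r0 rP] := bounds c eta cab eta0; exists r => // s t *.
  by have := rP s t; rewrite ler_norml; lra.
by rewrite -!/(g _) ler_norml; lra.
Qed.

Section Spacetime.
Context {n : nat}.
Local Notation E := ('cV[R]_n * R)%type.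

(** The differential at a point, with space gradient g and time derivative k. *)
Definition spacetime_form (g : 'I_n -> R) (k : R) (w : E) : R :=
  \sum_i g i * w.1 i 0 + k * w.2.

Lemma spacetime_norm_lt (w : E) (r : R) : 0 < r ->
  (`|w| < r) <-> ((forall i, `|w.1 i 0| < r) /\ `|w.2| < r).
Proof.
move=> r0; rewrite prod_normE gt_max [`|w.1|]mx_normrE; split.
  move=> /andP[/bigmax_ltP[_ wr] ->]; split=> // i.
  exact: (wr (i, 0)).
move=> [w1 ->]; rewrite andbT; apply/bigmax_ltP; split=> // -[i j] _ /=.
by rewrite ord1.
Qed.

Lemma spacetime_coord_le (w : E) :
  (forall i, `|w.1 i 0| <= `|w|) /\ `|w.2| <= `|w|.
Proof.
rewrite prod_normE !le_max lexx orbT; split=> // i.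
rewrite le_max [`|w.1|]mx_normrE; apply/orP; left.
exact: (le_bigmax _ _ (i, 0)).
Qed.

Lemma spacetime_form_le (g : 'I_n -> R) (k : R) (w : E) :
  `|spacetime_form g k w| <= (\sum_i `|g i| + `|k|) * `|w|.
Proof.
have [w1 w2] := spacetime_coord_le w.
rewrite mulrDl mulr_suml; apply: le_trans (ler_normD _ _) _.
apply: lerD; last by rewrite normrM ler_wpM2l.
apply: le_trans (ler_norm_sum _ _ _) _; apply: ler_sum => i _.
by rewrite normrM ler_wpM2l.
Qed.

Lemma spacetime_formD (g : 'I_n -> R) (k : R) (v w : E) :
  spacetime_form g k (v + w) = spacetime_form g k v + spacetime_form g k w.
Proof.
rewrite /spacetime_form /= mulrDr addrACA -big_split /=; congr (_ + _).
by apply: eq_bigr => i _; rewrite mxE mulrDr.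
Qed.

Lemma spacetime_formZ (g : 'I_n -> R) (k a : R) (w : E) :
  spacetime_form g k (a *: w) = a * spacetime_form g k w.
Proof.
rewrite /spacetime_form /= mulrDr mulr_sumr; congr (_ + _).
  by apply: eq_bigr => i _; rewrite mxE mulrCA.
by rewrite mulrCA.
Qed.

(** Changing the space coordinates from y to y' one at a time moves along
segments parallel to the axes.  These stay in the ball around z because the norm
is the maximum of the coordinates, and in the half space because the time is
fixed. *)
Lemma coordinatewise_increment (t0 : R) (V : E -> R) (p : 'I_n -> E -> R)
    (g : 'I_n -> R) (z : E) (r e : R) (y y' : E) : 0 < r -> 0 <= e ->
    (forall i z, space_time t0 z ->
      (V (z + h *: (delta_mx i 0, 0)) - V z) / h
        @[h --> within [set h | space_time t0 (z + h *: (delta_mx i 0, 0))] 0^']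
        --> p i z) ->
    (forall z', space_time t0 z' -> `|z' - z| < r -> forall i, `|p i z' - g i| <= e) ->
    space_time t0 y -> `|y - z| < r -> `|y' - z| < r ->
  `|V (y'.1, y.2) - V y - \sum_i g i * (y'.1 - y.1) i 0| <= e * n%:R * `|y' - y|.
Proof.
move=> r0 e0 Vp pg Dy yz y'z.
pose u k : E := (\col_i (if (i < k)%N then y'.1 i 0 else y.1 i 0), y.2).
have u0 : u 0%N = y.
  by rewrite [y]surjective_pairing; congr (_, _); apply/colP => i; rewrite mxE.
have un : u n = (y'.1, y.2).
  by congr (_, _); apply/colP => i; rewrite mxE ltn_ord.
have /spacetime_norm_lt [//|yz1 yz2] := yz.
have /spacetime_norm_lt [//|y'z1 y'z2] := y'z.
have step (i : 'I_n) :
    `|V (u i.+1) - V (u i) - g i * (y'.1 - y.1) i 0| <= e * `|y' - y|.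
  pose dl := (y'.1 - y.1) i 0; pose w : E := (delta_mx i 0, 0).
  have uS : u i.+1 = u i + dl *: w.
    congr (_, _); last by rewrite /w /= [_ *: _]scaler0 addr0.
    apply/colP => j; rewrite !mxE ltnS eqxx andbT.
    have [->|ij] := eqVneq j i; first by rewrite leqnn ltnn mulr1 /dl !mxE subrKC.
    rewrite mulr0 addr0 leq_eqVlt (_ : (j == i :> nat) = false) //.
    exact: negbTE ij.
  (* The i-th change may go in either direction along the axis. *)
  have Dh (h : R) : Num.min 0 dl <= h <= Num.max 0 dl ->
      space_time t0 (u i + h *: w) /\ `|p i (u i + h *: w) - g i| <= e.
    move=> hdl; have Du : space_time t0 (u i + h *: w).
      by rewrite /space_time /w /= [_ *: _]scaler0 addr0.
    split=> //; apply: pg => //; apply/spacetime_norm_lt => //; split.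
      move=> j /=; rewrite !mxE eqxx andbT.
      have [->|ij] := eqVneq j i; last first.
        by rewrite mulr0 addr0; case: ifP => _; [have := y'z1 j | have := yz1 j]; rewrite !mxE.
      rewrite ltnn mulr1; move: hdl (y'z1 i) (yz1 i); rewrite /dl !mxE !ltr_norml.
      by case: (lerP 0 _) => ?; lra.
    by rewrite /w /= [_ *: _]scaler0 addr0.
  have dlN : `|dl| <= `|y' - y| by exact: (spacetime_coord_le (y' - y)).1.
  apply: le_trans (ler_wpM2l e0 dlN); rewrite uS.
  have [dl0|dl0] := lerP 0 dl.
    have := increment_along _ _ V (p i) (u i) w 0 dl (g i) e dl0 (Vp i).
    rewrite scale0r addr0 !subr0 (ger0_norm dl0); apply=> h hdl; apply: Dh.
    by rewrite min_l // max_r.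
  have Dh' h : dl <= h <= 0 ->
      space_time t0 (u i + h *: w) /\ `|p i (u i + h *: w) - g i| <= e.
    by move=> hdl; apply: Dh; rewrite (min_r (ltW dl0)) (max_l (ltW dl0)).
  have := increment_along _ _ V (p i) (u i) w dl 0 (g i) e (ltW dl0) (Vp i) Dh'.
  rewrite scale0r addr0 !sub0r (ltr0_norm dl0) -/dl !ler_norml !mulrN.
  by lra.
rewrite -un -[in V y]u0 -(telescope_sumr (fun k => V (u k)) (leq0n n)) big_mkord.
rewrite -sumrB; apply: le_trans (ler_norm_sum _ _ _) _.
apply: le_trans (ler_sum _ (fun i _ => step i)) _.
by rewrite sumr_const card_ord -[leLHS]mulr_natr [leLHS]mulrAC.
Qed.

Definition strictly_differentiable (D : set E) (V : E -> R) (z : E)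
    (g : 'I_n -> R) (k : R) : Prop :=
  forall e : R, 0 < e -> exists2 r, 0 < r &
    forall y y', D y -> D y' -> `|y - z| < r -> `|y' - z| < r ->
      `|V y' - V y - spacetime_form g k (y' - y)| <= e * `|y' - y|.

(** The last move, in the time direction, joins two points of the half space, so
it stays inside; each of the n + 1 moves is allowed the error e / (n + 1). *)
Lemma C1_strictly_differentiable (t0 : R) (V : E -> R) :
    C1_in_x (space_time t0) V -> C1_in_t (space_time t0) V ->
  exists (g : E -> 'I_n -> R) (k : E -> R),
    forall z, space_time t0 z ->
      strictly_differentiable (space_time t0) V z (g z) (k z).
Proof.
move=> Cx [q Vq cq].
have /boolp.choice[p pP] : forall i : 'I_n, exists p : E -> R,
    (forall z, space_time t0 z ->
      (V (z + h *: (delta_mx i 0, 0)) - V z) / h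
        @[h --> within [set h | space_time t0 (z + h *: (delta_mx i 0, 0))] 0^']
        --> p z) /\ {within space_time t0, continuous p}.
  by move=> i; have [p Vp cp] := Cx i; exists p.
have Vp i := (pP i).1.
exists (fun z i => p i z), q => z Dz e e0.
pose d := e / n.+1%:R; have d0 : 0 < d by apply: divr_gt0; rewrite ?ltr0n.
have within_near (f : E -> R) : {within space_time t0, continuous f} ->
    \forall z' \near z, space_time t0 z' -> `|f z' - f z| <= d.
  move=> /(_ z) /=; rewrite /continuous_at => cf.
  have : f z' @[z' --> within (space_time t0) (nbhs z)] --> f z.
    by rewrite (nbhs_subspace_in Dz); exact: cf.
  move=> /cvgrPdist_le/(_ _ d0) fz.
  by apply: filterS fz => z'; rewrite distrC.
have : \forall z' \near z, (forall i, space_time t0 z' -> `|p i z' - p i z| <= d)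
    /\ (space_time t0 z' -> `|q z' - q z| <= d).
  apply: filterI; last exact: within_near.
  apply: (@filter_forall _ _
    (fun i z' => space_time t0 z' -> `|p i z' - p i z| <= d) _ (nbhs_filter z)) => i.
  exact: within_near (pP i).2.
move=> /nbhs_normP[r /= r0 rP]; exists r => // y y' Dy Dy' yz y'z.
have pd i z' : space_time t0 z' -> `|z' - z| < r -> `|p i z' - p i z| <= d.
  by move=> Dz' z'z; apply: (rP z' _).1 => //=; rewrite distrC.
have qd z' : space_time t0 z' -> `|z' - z| < r -> `|q z' - q z| <= d.
  by move=> Dz' z'z; apply: (rP z' _).2 => //=; rewrite distrC.
have xstep := coordinatewise_increment t0 V p (p^~ z) z r d y y' r0 (ltW d0) Vp
  (fun z' Dz' z'z i => pd i z' Dz' z'z) Dy yz y'z.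
have /spacetime_norm_lt [//|yz1 yz2] := yz.
have /spacetime_norm_lt [//|y'z1 y'z2] := y'z.
have yE h : (y'.1, 0) + h *: (0, 1) = (y'.1, h) :> E.
  by congr (_, _); rewrite /= ?scaler0 ?addr0 // add0r [LHS]mulr1.
have tstep s t : t0 <= s -> s <= t -> `|s - z.2| < r -> `|t - z.2| < r ->
    `|V (y'.1, t) - V (y'.1, s) - q z * (t - s)| <= d * (t - s).
  move=> t0s st sz tz; rewrite -(yE t) -(yE s).
  apply: (increment_along _ _ V q _ _ s t (q z) d st Vq) => h sht.
  have Dh : space_time t0 (y'.1, h) by rewrite /space_time /=; lra.
  rewrite yE; split=> //; apply: qd => //; apply/spacetime_norm_lt => //; split=> //=.
  by move: sz tz; rewrite !ltr_norml; lra.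
have tstep' : `|V y' - V (y'.1, y.2) - q z * (y'.2 - y.2)| <= d * `|y' - y|.
  have : `|y'.2 - y.2| <= `|y' - y| := (spacetime_coord_le (y' - y)).2.
  move=> /(ler_wpM2l (ltW d0)).
  apply: le_trans; move: Dy Dy'; rewrite /space_time /= => Dy Dy'.
  have -> : V y' = V (y'.1, y'.2) by rewrite -surjective_pairing.
  case: (lerP y.2 y'.2) => yy'.
    exact: tstep.
  have := tstep _ _ Dy' (ltW yy') y'z2 yz2.
  by rewrite !ler_norml; lra.
have dE : d * n%:R + d = e.
  by rewrite -[X in _ + X]mulr1 -mulrDr natr1 mulfVK ?pnatr_eq0.
rewrite -dE mulrDl; apply: le_trans (lerD xstep tstep').
apply: le_trans (ler_normD _ _); rewrite le_eqVlt; apply/orP; left; apply/eqP.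
by congr `|_|; rewrite /spacetime_form /=; ring.
Qed.

End Spacetime.
End StrictDifferentiability.

(** * Contingent derivatives and convex hulls *)

Section Contingent.
Context {R : realType}.
Context {n : nat}.
Local Notation E := ('cV[R]_n * R)%type.
Implicit Types (g : 'I_n -> R) (k : R).

Lemma exists_small (a e : R) : 0 <= a -> 0 < e -> exists d : R, [/\ 0 < d, d <= 1 & d * a <= e].
Proof.
move=> a0 e0; exists (Num.min 1 (e / (a + 1))).
have h : 0 < e / (a + 1) by apply: divr_gt0; lra.
split; first by rewrite lt_min ltr01.
  by rewrite ge_min lexx.
apply: (@le_trans _ _ (e / (a + 1) * a)).
  by rewrite ler_wpM2r // ge_min lexx orbT.
rewrite mulrAC ler_pdivrMr; last by lra.
by rewrite ler_pM2l //; lra.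
Qed.

(** The condition 0 < f.2 keeps z + h *: v in the half space for all v near f and
h > 0, where strict differentiability bounds the difference quotient below. *)
Lemma le_upper_contingent_derivative (t0 : R) (V : E -> R) (z f : E) g k :
    space_time t0 z -> 0 < f.2 ->
    strictly_differentiable (space_time t0) V z g k ->
  ((spacetime_form g k f)%:E <= upper_contingent_derivative V z f)%E.
Proof.
move=> Dz f2 Vz; apply/lee_subgt0Pr => e e0; rewrite -EFinB.
pose K := \sum_i `|g i| + `|k|.
have K0 : 0 <= K by apply: addr_ge0 => //; apply: sumr_ge0.
have [eta' [eta'0 _ eta'K]] := exists_small K (e / 2) K0 ltac:(lra).
pose eta := Num.min 1 (Num.min eta' f.2).
have eta0 : 0 < eta by rewrite !lt_min ltr01 eta'0.
have eta1 : eta <= 1 by rewrite ge_min lexx.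
have etaf : eta <= f.2 by rewrite !ge_min lexx !orbT.
have etaK : eta * K <= e / 2.
  by apply: le_trans eta'K; rewrite ler_wpM2r // !ge_min lexx orbT.
have [d [d0 _ df]] := exists_small (`|f| + 1) (e / 2) ltac:(by rewrite addr_ge0) ltac:(lra).
have [r r0 rV] := Vz d d0.
have [h0 [h00 _ h0f]] := exists_small (`|f| + 1) (r / 2) ltac:(by rewrite addr_ge0) ltac:(lra).
rewrite /upper_contingent_derivative limf_einfE; apply: ereal_sup_ge.
have fN : \forall v \near f, `|f - v| < eta by apply/nbhs_normP; exists eta.
set A := [set p : R * E | (0 < p.1 < h0) /\ `|f - p.2| < eta].
exists (ereal_inf ((fun p : R * E => ((V (z + p.1 *: p.2) - V z) / p.1)%:E) @` A)).
  exists A => //; exists ([set h : R | 0 < h < h0], [set v : E | `|f - v| < eta]).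
    split; last exact: fN.
    near=> h; apply/andP; split; near: h; [exact: nbhs_right_gt | exact: nbhs_right_lt].
  by move=> [h v] [].
apply: le_ereal_inf_tmp => _ [[h v] [/= /andP[hgt0 hh0] vf] <-]; rewrite lee_fin.
have v1 : `|v| <= `|f| + 1.
  rewrite -[v](subrKC f) -[v - f]opprB; apply: le_trans (ler_normB _ _) _; lra.
have v2 : 0 <= v.2.
  have := (spacetime_coord_le (f - v)).2; rewrite [_.2]/(f.2 - v.2) => H.
  by have := ler_norm (f.2 - v.2); lra.
have hv : `|h *: v| < r.
  rewrite normrZ gtr0_norm //; apply: (@le_lt_trans _ _ (h0 * (`|f| + 1))).
    by apply: ler_pM => //; exact: ltW.
  by lra.
have := rV z (z + h *: v) Dz; rewrite [z + h *: v]addrC addrK subrr normr0 => H.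
have {}H := H _ r0 hv.
have fv : `|spacetime_form g k (v - f)| <= e / 2.
  apply: le_trans (spacetime_form_le _ _ _) _; rewrite -/K distrC mulrC.
  by apply: le_trans etaK; rewrite ler_wpM2r // ltW.
have fE : spacetime_form g k v = spacetime_form g k f + spacetime_form g k (v - f).
  by rewrite -spacetime_formD subrKC.
rewrite ler_pdivlMr //.
have dv : d * `|h *: v| <= h * (e / 2).
  rewrite normrZ gtr0_norm // mulrCA ler_pM2l //.
  by apply: le_trans df; rewrite ler_pM2l.
have : `|V (h *: v + z) - V z - h * spacetime_form g k v| <= h * (e / 2).
  apply: le_trans dv; rewrite -spacetime_formZ; apply: H.
  by move: Dz; rewrite /space_time /= => Dz; rewrite ler_wpDl // mulr_ge0 // ltW.
rewrite fE; move: fv; rewrite !ler_norml; nra.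
Unshelve. all: by end_near. Qed.

(** Directions with time component 1 form an affine hyperplane, on which the
condition that the differential is nonpositive cuts out a half space. *)
Lemma convex_hull_spacetime_form g k (A : set 'cV[R]_n) (v : 'cV[R]_n) :
    (forall w, A w -> spacetime_form g k (w, 1) <= 0) ->
    convex_hull A v ->
  spacetime_form g k (v, 1) <= 0.
Proof.
move=> Ag /(_ [set w | spacetime_form g k (w, 1) <= 0]); apply; split=> //.
move=> x y l; rewrite !inE /= => gx gy.
have -> : (conv l x y, 1) = l%:num *: (x, 1) + (1 - l%:num) *: (y, 1) :> E.
  by congr (_, _); rewrite /= ![_ *: 1]mulr1 subrKC.
rewrite spacetime_formD !spacetime_formZ.
have l0 : 0 <= l%:num by [].
have l1 : l%:num <= 1 by [].
by move: (l%:num) l0 l1 => c c0 c1; nra.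
Qed.

End Contingent.

(** * Monotonicity along trajectories *)

Section Trajectories.
Context {R : realType}.
Context {n : nat}.
Local Notation E := ('cV[R]_n * R)%type.
Implicit Types (a b : R) (x : R -> 'cV[R]_n) (g : 'I_n -> R) (k : R).

Lemma absolutely_continuous_near a b x c e :
    absolutely_continuous a b x -> a <= c <= b -> 0 < e ->
  exists2 r, 0 < r & forall s, a <= s <= b -> `|s - c| < r -> `|x s - x c| < e.
Proof.
move=> acx /andP[ac cb] e0; have [r r0 xr] := acx e e0.
exists r => // s /andP[as_ sb].
have tI (I : 'I_1 -> R * R) : trivIset setT (fun i => `](I i).1, (I i).2[%classic).
  by move=> i j _ _ _; rewrite (ord1 i) (ord1 j).
case: (leP c s) => cs sr.
  have := xr 1%N (fun=> (c, s)) _ (tI _); rewrite !big_ord1 /=; apply=> //.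
  by move: sr; rewrite ger0_norm ?subr_ge0.
have := xr 1%N (fun=> (s, c)) _ (tI _).
rewrite !big_ord1 /= [X in _ -> _ -> X < _]distrC; apply=> //.
  by split=> //; exact: ltW.
by move: sr; rewrite ltr0_norm ?subr_lt0 // opprB.
Qed.

Lemma sum_absolutely_continuous_lipschitz a b x (f : R -> R) (C : R) :
    absolutely_continuous a b x -> 0 <= C ->
    (forall s t, a <= s -> s <= t -> t <= b ->
      f t - f s <= C * (`|x t - x s| + (t - s))) ->
  sum_absolutely_continuous a b (fun s t => f t - f s).
Proof.
move=> acx C0 fC e e0.
pose e' := e / (2 * (C + 1)).
have e'0 : 0 < e' by apply: divr_gt0 => //; lra.
have e'C : C * (2 * e') < e.
  have C1 : C + 1 != 0 by apply: lt0r_neq0; lra.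
  have e'E : 2 * e' * (C + 1) = e by rewrite /e'; field.
  by rewrite -[ltRHS]e'E; nra.
have [d d0 xd] := acx e' e'0.
exists (Num.min d e'); first by rewrite lt_min d0.
move=> k I Iab tI; rewrite lt_min => /andP[Id Ie'].
apply: le_lt_trans e'C.
apply: (@le_trans _ _ (\sum_(i < k) C * (`|x (I i).2 - x (I i).1| + ((I i).2 - (I i).1)))).
  by apply: ler_sum => i _; have [? ? ?] := Iab i; exact: fC.
rewrite -mulr_sumr ler_wpM2l // big_split /=.
by have := xd k I Iab tI Id; lra.
Qed.

Lemma derivable_increment x c e : derivable x c 1 -> 0 < e ->
  exists2 r, 0 < r & forall s, `|s - c| < r ->
    `|x s - x c - (s - c) *: derive1 x c| <= e * `|s - c|.
Proof.
move=> dx e0.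
have /cvgrPdist_le/(_ _ e0)/nbhs_norm0P[r /= r0 rP] :
    h^-1 *: (x (h + c) - x c) @[h --> 0^'] --> derive1 x c.
  have := dx; rewrite /derivable /derive1.
  by under eq_fun do rewrite /= [_ *: 1]mulr1.
exists r => // s sr; have [->|sc] := eqVneq s c.
  by rewrite !subrr scale0r subr0 !normr0 mulr0.
have sc0 : s - c != 0 by rewrite subr_eq0.
have := rP _ sr sc0; rewrite /= subrK distrC => H.
rewrite [X in `|X|](_ : _ =
    (s - c) *: ((s - c)^-1 *: (x s - x c) - derive1 x c)).
  by rewrite normrZ mulrC ler_wpM2r.
by rewrite scalerBr scalerA divff // scale1r.
Qed.

Lemma strictly_differentiable_lipschitz (D : set E) (V : E -> R) (z : E) g k :
    strictly_differentiable D V z g k ->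
  exists C, 0 <= C /\ exists2 r, 0 < r & forall y y', D y -> D y' ->
    `|y - z| < r -> `|y' - z| < r -> `|V y' - V y| <= C * `|y' - y|.
Proof.
move=> Vz; have [r r0 rV] := Vz 1 ltr01.
exists (\sum_i `|g i| + `|k| + 1); split.
  by rewrite !addr_ge0 //; apply: sumr_ge0.
exists r => // y y' Dy Dy' yz y'z.
rewrite -(subrK (spacetime_form g k (y' - y)) (V y' - V y)) mulrDl addrC.
apply: le_trans (ler_normD _ _) _; apply: lerD; last exact: rV.
exact: spacetime_form_le.
Qed.

(** The chain rule for increments over intervals [s, t] that contain c, where the
velocity w exists only at c. *)
Lemma local_increment_along_curve (D : set E) (V : E -> R) (y : R -> E)
    (w : E) g k (c e : R) :
    strictly_differentiable D V (y c) g k ->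
    (forall eta, 0 < eta -> exists2 r, 0 < r & forall s, `|s - c| < r ->
      `|y s - y c - (s - c) *: w| <= eta * `|s - c|) ->
    spacetime_form g k w <= 0 -> 0 < e ->
  exists2 r, 0 < r & forall s t, c - r <= s -> s <= c -> c <= t -> t <= c + r ->
    D (y s) -> D (y t) -> V (y t) - V (y s) <= e * (t - s).
Proof.
move=> Vc dy Vw e0; pose K := \sum_i `|g i| + `|k|.
have K0 : 0 <= K by apply: addr_ge0 => //; apply: sumr_ge0.
have w1 : 0 <= `|w| + 1 by rewrite addr_ge0.
have [eta [eta0 eta1 etaK]] := exists_small K (e / 2) K0 ltac:(lra).
have [d [d0 _ dw]] := exists_small (`|w| + 1) (e / 2) w1 ltac:(lra).
have [r1 r10 Vr1] := Vc d d0.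
have [r2 r20 yr2] := dy eta eta0.
have [m [m0 _ mw]] := exists_small (`|w| + 1) (r1 / 2) w1 ltac:(lra).
pose r := Num.min m (r2 / 2).
have rm : r <= m by rewrite ge_min lexx.
have rr2 : r <= r2 / 2 by rewrite ge_min lexx orbT.
have r0 : 0 < r by rewrite lt_min m0 divr_gt0.
exists r => // s t cs sc ct tc Ds Dt.
have near_c v : `|v - c| <= r ->
    `|y v - y c| < r1 /\ `|y v - y c - (v - c) *: w| <= eta * `|v - c|.
  move=> vc; have yv := yr2 v ltac:(lra); split=> //.
  rewrite -(subrK ((v - c) *: w) (y v - y c)).
  apply: le_lt_trans (ler_normD _ _) _; rewrite normrZ.
  have : eta * `|v - c| <= `|v - c| by rewrite ler_piMl.
  have : `|v - c| * (`|w| + 1) <= m * (`|w| + 1) by rewrite ler_wpM2r //; lra.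
  by lra.
have sE : `|s - c| = c - s by rewrite distrC ger0_norm ?subr_ge0.
have tE : `|t - c| = t - c by rewrite ger0_norm ?subr_ge0.
have [|ys os] := near_c s; first by rewrite sE; lra.
have [|yt ot] := near_c t; first by rewrite tE; lra.
have := Vr1 _ _ Ds Dt ys yt; rewrite ler_norml => /andP[_].
pose o : E := y t - y s - (t - s) *: w.
have oE : y t - y s = (t - s) *: w + o by rewrite subrKC.
(* The errors at s and t are proportional to c - s and t - c, whose sum is t - s
   because c lies between s and t. *)
have o_le : `|o| <= eta * (t - s).
  have -> : o = (y t - y c - (t - c) *: w) - (y s - y c - (s - c) *: w).
    rewrite /o (_ : (t - s) *: w = (t - c) *: w - (s - c) *: w).
      by rewrite [in RHS]opprD opprK addrACA !opprB subrKA (addrC (- _)).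
    by rewrite -scalerBl opprB subrKA.
  apply: le_trans (ler_normB _ _) _; move: os ot; rewrite sE tE; lra.
move: oE o_le; clearbody o => oE o_le.
have st : 0 <= t - s by lra.
have dst : `|y t - y s| <= (t - s) * (`|w| + 1).
  rewrite oE; apply: le_trans (ler_normD _ _) _.
  rewrite normrZ (ger0_norm st).
  have : eta * (t - s) <= t - s by rewrite ler_piMl.
  by lra.
have fo : spacetime_form g k o <= e / 2 * (t - s).
  apply: le_trans (ler_norm _) _; apply: le_trans (spacetime_form_le _ _ _) _.
  apply: le_trans (ler_wpM2l K0 o_le) _.
  by rewrite mulrA [K * _]mulrC ler_wpM2r.
have fw : (t - s) * spacetime_form g k w <= 0 by rewrite mulr_ge0_le0.
have ddst : d * `|y t - y s| <= e / 2 * (t - s).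
  apply: le_trans (ler_wpM2l (ltW d0) dst) _.
  by rewrite mulrCA mulrC ler_wpM2r.
rewrite {1}oE spacetime_formD spacetime_formZ.
by move: fo fw ddst; lra.
Qed.

(** It suffices to compare times close to a given c, where a single Lipschitz
constant of V is available around (x c, c). *)
Lemma nonincreasing_along_trajectory (t0 a b : R) (V : E -> R)
    (g : E -> 'I_n -> R) (k : E -> R) x : t0 <= a -> a <= b ->
    (forall z, space_time t0 z ->
      strictly_differentiable (space_time t0) V z (g z) (k z)) ->
    absolutely_continuous a b x ->
    {ae @lebesgue_measure R, forall t : R, a <= t <= b -> derivable x t 1 /\
      spacetime_form (g (x t, t)) (k (x t, t)) (derive1 x t, 1) <= 0} ->
  V (x b, b) <= V (x a, a).
Proof.
move=> t0a ab Vd acx aex.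
apply: (cousin_interval _ _ (fun s t => V (x t, t) <= V (x s, s))) => //.
  by move=> s t u _ _ _ _ ts ut; exact: le_trans ut ts.
move=> c cab.
have Dx u : a <= u -> space_time t0 (x u, u) by exact: le_trans.
have [C [C0 [r r0 Vr]]] :=
  strictly_differentiable_lipschitz _ _ _ _ _ (Vd _ (Dx c (andP cab).1)).
have [r1 r10 xr1] := absolutely_continuous_near _ _ _ _ _ acx cab r0.
pose rho := Num.min r r1 / 2.
have rho0 : 0 < rho by rewrite divr_gt0 // lt_min r0.
have rhor : rho < r.
  by rewrite ltr_pdivrMr // gt_min; apply/orP; left; lra.
have rhor1 : rho < r1.
  by rewrite ltr_pdivrMr // gt_min; apply/orP; right; lra.
exists rho => // s t as_ cs sc ct tc tb.
have near_c u : s <= u -> u <= t -> `|(x u, u) - (x c, c)| < r.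
  move=> su ut; have uc : `|u - c| <= rho by rewrite ler_norml; lra.
  rewrite prod_normE gt_max /= xr1; [|lra|exact: le_lt_trans uc rhor1].
  exact: le_lt_trans uc rhor.
apply: (le_of_ae_local (fun u => V (x u, u)) s t _ (le_trans sc ct) _ aex).
  apply: (sum_absolutely_continuous_lipschitz _ _ x _ C) => //.
    move=> e e0; have [d d0 xd] := acx e e0; exists d => // m I Ist.
    apply: xd => i; have [sI ? It] := Ist i.
    by split=> //; [exact: le_trans sI | exact: le_trans tb].
  move=> u v su uv vt.
  have au := le_trans as_ su.
  have := Vr (x u, u) (x v, v) (Dx u au) (Dx v (le_trans au uv))
    (near_c u su (le_trans uv vt)) (near_c v (le_trans su uv) vt).
  rewrite ler_norml => /andP[_ H]; apply: le_trans H _; rewrite ler_wpM2l //.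
  rewrite prod_normE ge_max /= lerDl subr_ge0 uv /= ger0_norm ?subr_ge0 //.
  by rewrite lerDr.
move=> u e /andP[su ut] /contrapT aeu e0.
have [|dxu Vu] := aeu; first by lra.
have Du : space_time t0 (x u, u) by apply: Dx; lra.
have [|r2 r20 Vr2] := local_increment_along_curve _ _ (fun v => (x v, v))
    (derive1 x u, 1) _ _ u e (Vd _ Du) _ Vu e0.
  move=> eta eta0; have [r2 r20 xr2] := derivable_increment _ _ _ dxu eta0.
  exists r2 => // v /xr2; rewrite prod_normE /= [_ *: 1]mulr1 subrr normr0.
  by rewrite ge_max => -> /=; rewrite mulr_ge0 // ltW.
exists r2 => // p q sp up pu uq qu qt; apply: Vr2 => //; apply: Dx; lra.
Qed.

End Trajectories.

Theorem corollary1 (R : realType) (n m L : nat) (S : spline_model R n m L)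
  (M : R) (sigma : R -> R) (tN T : R) (xN : 'cV[R]_n) (X Xu : set 'cV[R]_n)
  (B Wplus Wminus : 'cV[R]_n * R -> R)
  (M_gt0 : 0 < M)
  (sigma_ge0 : forall t : R, 0 <= t -> 0 <= sigma t)
  (tN_ge0 : 0 <= tN)
  (tN_lt_T : tN < T)
  (B_C1_x : C1_in_x (space_time tN) B)
  (B_C1_t : C1_in_t (space_time tN) B)
  (Wplus_ge0 : forall z, space_time tN z -> 0 <= Wplus z)
  (Wminus_ge0 : forall z, space_time tN z -> 0 <= Wminus z)
  (Wplus_pd : positive_definite (space_time tN) Wplus)
  (Wminus_pd : positive_definite (space_time tN) Wminus)
  (Wplus_meas : lebesgue_measurable_fun (space_time tN) Wplus)
  (Wminus_meas : lebesgue_measurable_fun (space_time tN) Wminus)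
  (B_unsafe : forall xT, Xu xT -> 0 < B (xT, T) - B (xN, tN))
  (B_minus : forall (t : R) (x : 'cV[R]_n), tN <= t <= T -> X x ->
    (upper_contingent_derivative B (x, t)
       (Xdot_minus S M sigma (cst 0%R) t, 1%R) <= (- Wminus (x, t))%:E)%E)
  (B_plus : forall (t : R) (x : 'cV[R]_n), tN <= t <= T -> X x ->
    (upper_contingent_derivative B (x, t)
       (Xdot_plus S M sigma (cst 0%R) t, 1%R) <= (- Wplus (x, t))%:E)%E) :
  forall x : R -> 'cV[R]_n,
    solution (fun t => convex_hull [set Xdot_minus S M sigma (cst 0) t;
                                        Xdot_plus S M sigma (cst 0) t])
             X tN T xN x ->
    ~ Xu (x T).
Proof.
move=> x [acx xX aex xa].
have [g [k Bd]] := C1_strictly_differentiable tN B B_C1_x B_C1_t.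
have decr : B (x T, T) <= B (x tN, tN).
  apply: (nonincreasing_along_trajectory tN tN T B g k x) => //; first exact: ltW.
  move: aex; apply: negligibleS => t nP aP; apply: nP => tT.
  have [dx Phix] := aP tT; split=> //.
  have /andP[tNt _] := tT.
  have Dt : space_time tN (x t, t) by [].
  have form_le0 w W : 0 <= W ->
      (upper_contingent_derivative B (x t, t) (w, 1%R) <= (- W)%:E)%E ->
      spacetime_form (g (x t, t)) (k (x t, t)) (w, 1) <= 0.
    move=> W0 DBW; rewrite -lee_fin; apply: le_trans.
      exact: (le_upper_contingent_derivative tN B _ (w, 1) _ _ Dt ltr01 (Bd _ Dt)).
    by apply: le_trans DBW _; rewrite lee_fin oppr_le0.
  apply: convex_hull_spacetime_form Phix => w [->|->].
    exact: form_le0 (Wminus_ge0 _ Dt) (B_minus t (x t) tT (xX t tT)).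
  exact: form_le0 (Wplus_ge0 _ Dt) (B_plus t (x t) tT (xX t tT)).
by move=> /B_unsafe; rewrite subr_gt0 -xa ltNge decr.
Qed.
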